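(* Let $(Z,\Omega,\mathcal L)$ be a holomorphic symplectic Morita equivalence with brane bisection between holomorphic Poisson manifolds $(X_\pm,\sigma_\pm)$. Let $I_\pm$ denote the complex structures induced on the brane $\mathcal L$ and let $F=\Omega|_{\mathcal L}$ denote the real 2-form on $\mathcal L$ obtained by pulling back the symplectic form. If $S_\pm=F^{(1,1)_\pm}I_\pm$ and $A_\pm=F^{(2,0)+(0,2)_\pm}I_\pm$, then $$S_+=S_-\qquad\text{and}\qquad A_+=-A_-.$$
   Context: Holomorphic symplectic Morita equivalence between $(X_-,\sigma_-)$ and $(X_+,\sigma_+)$: a holomorphic symplectic manifold $(Z,\Omega)$ with holomorphic surjective submersions $\pi_\pm:Z\to X_\pm$ with connected, simply connected fibres such that $\pi_+$ is Poisson, $\pi_-$ is anti-Poisson, $\ker d\pi_+$ and $\ker d\pi_-$ are symplectic orthogonals of each other, and $\pi_\pm$ are complete (pullbacks of complete Hamiltonian vector fields are complete). Brane bisection: a smooth submanifold $\mathcal L\subset Z$, Lagrangian for $\mathrm{Im}(\Omega)$, which is a section of both $\pi_+$ and $\pi_-$ (i.e. $\pi_\pm|_{\mathcal L}$ are diffeomorphisms onto $X_\pm$). The induced complex structures $I_\pm$ on $\mathcal L$ are the pullbacks, by the diffeomorphisms $\pi_\pm|_{\mathcal L}$, of the complex structures of $X_\pm$. $F^{(1,1)_\pm}$ and $F^{(2,0)+(0,2)_\pm}$ are the components of $F$ of the indicated types with respect to $I_\pm$. For a 2-form $F$ and complex structure $I$, $FI$ denotes the bilinear tensor $(u,v)\mapsto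 F(Iu,v)$; $F^{(1,1)}I$ is its symmetric part and $F^{(2,0)+(0,2)}I$ its anti-symmetric part. *)

(* Defs.v *)
From HB Require Import structures.
From mathcomp Require Import all_boot all_order all_algebra.
From mathcomp Require Import all_classical all_reals all_analysis.
From mathcomp.real_closed Require Import complex.
From mathcomp Require Import ring lra.

Set Implicit Arguments.
Unset Strict Implicit.
Unset Printing Implicit Defensive.

Import Order.TTheory GRing.Theory Num.Theory.
Import numFieldNormedType.Exports.

Local Open Scope classical_set_scope.
Local Open Scope ring_scope.
Local Open Scope complex_scope.

Fixpoint Ck (R : realType) (V W : normedModType R) (U : set V) (k : nat)
    (f : V -> W) : Prop :=
  match k with
  | 0 => forall x, U x -> {for x, continuous f}
  | k'.+1 => (forall x, U x -> differentiable f x) /\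
             (forall v, Ck U k' (fun x => 'd f x v))
  end.

Definition smooth_on (R : realType) (V W : normedModType R) (U : set V)
  (f : V -> W) : Prop := forall k, Ck U k f.

(* The pair (x, y) of real row vectors stands for x + i y in C^n; Cn R n is
   used as a real normed space, and cJ is the multiplication by i. *)
Notation Cn R n := ('rV[R]_n * 'rV[R]_n)%type.

Definition cJ (R : realType) (n : nat) (x : Cn R n) : Cn R n := (- x.2, x.1).

Definition ce (R : realType) (n : nat) (j : 'I_n) : Cn R n := (delta_mx 0 j, 0).

Definition holo_on (R : realType) (m n : nat) (U : set (Cn R m))
    (f : Cn R m -> Cn R n) : Prop :=
  smooth_on U f /\ forall x v, U x -> 'd f x (cJ v) = cJ ('d f x v).

Definition cdiff (R : realType) (V : normedModType R) (f : V -> R[i])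
    (x v : V) : R[i] :=
  'd (fun y => complex.Re (f y) : R) x v +i* 'd (fun y => complex.Im (f y) : R) x v.

Definition choloC_on (R : realType) (n : nat) (U : set (Cn R n))
    (f : Cn R n -> R[i]) : Prop :=
  [/\ smooth_on U (fun y => complex.Re (f y) : R),
      smooth_on U (fun y => complex.Im (f y) : R) &
      forall x v, U x -> cdiff f x (cJ v) = 'i%C * cdiff f x v].

(* chart_map and chart_inv are total functions, relevant only on chart_dom and
   on its image respectively. *)
Record chart (R : realType) (T : topologicalType) (E : normedModType R) := Chart {
  chart_dom : set T;
  chart_map :> T -> E;
  chart_inv : E -> T;
  chart_dom_open : open chart_dom;
  chart_img_open : open (chart_map @` chart_dom);
  chart_mapK : forall p, chart_dom p -> chart_inv (chart_map p) = p;
  chart_map_cont : forall p, chart_dom p -> {for p, continuous chart_map};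
  chart_inv_cont : forall x, (chart_map @` chart_dom) x ->
    {for x, continuous chart_inv}
}.

(* A manifold modelled on E whose transition maps belong to G. Every point
   carries a preferred chart of the atlas: a tangent vector at p is represented
   by its components in E with respect to chart_at p, so that E is used as the
   tangent space at every point. *)
Record manifold (R : realType) (E : normedModType R)
    (G : set E -> (E -> E) -> Prop) := Manifold {
  carrier :> topologicalType;
  atlas : set (chart carrier E);
  chart_at : carrier -> chart carrier E;
  chart_at_atlas : forall p, atlas (chart_at p);
  chart_at_dom : forall p, chart_dom (chart_at p) p;
  atlas_compat : forall c d, atlas c -> atlas d ->
    G (c @` (chart_dom c `&` chart_dom d)) (d \o chart_inv c);
  manifold_hausdorff : hausdorff_space carrier;
  manifold_second_countable : @second_countable carrier
}.

Definition smooth_manifold (R : realType) (m : nat) :=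
  manifold (fun (U : set 'rV[R]_m) (f : 'rV[R]_m -> 'rV[R]_m) => smooth_on U f).

Definition complex_manifold (R : realType) (n : nat) :=
  manifold (fun (U : set (Cn R n)) (f : Cn R n -> Cn R n) => holo_on U f).

Section Maps.
Context {R : realType} {E E' : normedModType R}.
Context {G : set E -> (E -> E) -> Prop} {G' : set E' -> (E' -> E') -> Prop}.
Variables (M : manifold G) (N : manifold G').

Definition map_of_type (Q : set E -> (E -> E') -> Prop) (f : M -> N) : Prop :=
  continuous f /\
  forall c d, atlas (m:=M) c -> atlas (m:=N) d ->
    Q (c @` (chart_dom c `&` f @^-1` chart_dom d)) (d \o f \o chart_inv c).

Definition smooth_map (f : M -> N) : Prop :=
  map_of_type (fun U g => smooth_on U g) f.

(* The tangent map at p, in the trivialisations at p and f p. *)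
Definition mdiff (f : M -> N) (p : M) : E -> E' :=
  'd (chart_at (f p) \o f \o chart_inv (chart_at p)) (chart_at p p).

End Maps.

Definition diffeo_pair (R : realType) (E E' : normedModType R)
    (G : set E -> (E -> E) -> Prop) (G' : set E' -> (E' -> E') -> Prop)
    (M : manifold G) (N : manifold G') (f : M -> N) (g : N -> M) : Prop :=
  [/\ smooth_map f, smooth_map g, cancel f g & cancel g f].

Definition smooth_embedding (R : realType) (E E' : normedModType R)
    (G : set E -> (E -> E) -> Prop) (G' : set E' -> (E' -> E') -> Prop)
    (M : manifold G) (N : manifold G') (f : M -> N) : Prop :=
  [/\ smooth_map f,
      forall p, injective (mdiff f p),
      injective f &
      forall V : set M, open V -> exists2 W : set N, open W & V = f @^-1` W].

Definition vector_field (R : realType) (E : normedModType R)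
  (G : set E -> (E -> E) -> Prop) (M : manifold G) := M -> E.

(* gamma t has velocity V (gamma t), both computed in chart_at (gamma t); time is
   real, also on complex manifolds. *)
Definition complete_on (R : realType) (E : normedModType R)
    (G : set E -> (E -> E) -> Prop) (M : manifold G)
    (U : set M) (V : vector_field M) : Prop :=
  forall p, U p -> exists gamma : R -> M,
    [/\ gamma 0 = p, continuous gamma, forall t, U (gamma t) &
        forall t, is_derive (t : R) (1 : R)
          (fun s : R => chart_at (gamma t) (gamma s) : E) (V (gamma t))].

(* The homotopies fix the base point. *)
Definition simply_connected (R : realType) (T : topologicalType) (A : set T) : Prop :=
  forall h : R -> T,
    {within `[0, 1], continuous h} -> (forall t, t \in `[0, 1] -> A (h t)) ->
    h 0 = h 1 ->
    exists H : R * R -> T,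
      [/\ {within `[0, 1] `*` `[0, 1], continuous H},
          forall s t, s \in `[0, 1] -> t \in `[0, 1] -> A (H (s, t)),
          forall t, t \in `[0, 1] -> H (0, t) = h t /\ H (1, t) = h 0 &
          forall s, s \in `[0, 1] -> H (s, 0) = h 0 /\ H (s, 1) = h 0].

Section Holomorphic.
Context {R : realType} {n : nat}.
Variable M : complex_manifold R n.

Definition holo_fun (U : set M) (f : M -> R[i]) : Prop :=
  forall c, atlas (m:=M) c ->
    choloC_on (c @` (chart_dom c `&` U)) (f \o chart_inv c).

Definition mcdiff (f : M -> R[i]) (p : M) : Cn R n -> R[i] :=
  cdiff (f \o chart_inv (chart_at p)) (chart_at p p).

Definition cform2 := M -> Cn R n -> Cn R n -> R[i].

(* Om q is expressed in chart_at q; tau changes from the chart c to chart_at q. *)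
Definition chart_form (Om : cform2) (c : chart M (Cn R n)) (x u v : Cn R n) : R[i] :=
  let q := chart_inv c x in
  let tau := 'd (chart_at q \o chart_inv c) x : Cn R n -> Cn R n in
  Om q (tau u) (tau v).

Definition holomorphic_symplectic (Om : cform2) : Prop :=
  (forall p w, (forall (a : R) u v,
       Om p (a *: u + v) w = a%:C * Om p u w + Om p v w) /\
     (forall u, Om p (cJ u) w = 'i%C * Om p u w)) /\
  (forall p u v, Om p u v = - Om p v u) /\
  (forall p u, (forall v, Om p u v = 0) -> u = 0) /\
  (forall c, atlas (m:=M) c -> forall u v,
     choloC_on (c @` chart_dom c) (fun x => chart_form Om c x u v)) /\
  (forall c, atlas (m:=M) c -> forall x, (c @` chart_dom c) x -> forall u v w,
     cdiff (fun y => chart_form Om c y v w) x u +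
     cdiff (fun y => chart_form Om c y w u) x v +
     cdiff (fun y => chart_form Om c y u v) x w = 0).

(* sigma p j k is the coefficient sigma^jk of the bivector field
   1/2 sum_jk sigma^jk (d/dz_j) /\ (d/dz_k) in the chart chart_at p. *)
Definition bivector_field := M -> 'M[R[i]]_n.

Definition bracket (sigma : bivector_field) (f g : M -> R[i]) : M -> R[i] :=
  fun p => \sum_j \sum_k sigma p j k * mcdiff f p (ce R j) * mcdiff g p (ce R k).

(* sigma(df), whose k-th component is sum_j sigma^jk df/dz_j; for holomorphic
   f and g one has dg (hamiltonian sigma f) = bracket sigma f g. *)
Definition hamiltonian (sigma : bivector_field) (f : M -> R[i]) : vector_field M :=
  fun p =>
    let X k := \sum_j sigma p j k * mcdiff f p (ce R j) in
    (\row_k complex.Re (X k), \row_k complex.Im (X k)).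

Definition holomorphic_poisson (sigma : bivector_field) : Prop :=
  [/\ forall p j k, sigma p j k = - sigma p k j,
      forall (U : set M) f g, open U -> holo_fun U f -> holo_fun U g ->
        holo_fun U (bracket sigma f g) &
      forall (U : set M) f g h, open U ->
        holo_fun U f -> holo_fun U g -> holo_fun U h ->
        forall p, U p ->
          bracket sigma f (bracket sigma g h) p +
          bracket sigma g (bracket sigma h f) p +
          bracket sigma h (bracket sigma f g) p = 0].

(* The Poisson structure Om^-1; the convention is that
   Om (hamiltonian (symplectic_bivector Om) f) = df. *)
Definition symplectic_bivector (Om : cform2) : bivector_field :=
  fun p => invmx (\matrix_(j, k) Om p (ce R j) (ce R k)).

End Holomorphic.

Section HolomorphicMaps.
Context {R : realType} {m n : nat}.
Variables (M : complex_manifold R m) (N : complex_manifold R n).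

Definition holo_map (f : M -> N) : Prop :=
  map_of_type (fun U g => holo_on U g) f.

Definition poisson_map (sM : bivector_field M) (sN : bivector_field N)
    (f : M -> N) : Prop :=
  forall (U : set N) g h, open U -> holo_fun U g -> holo_fun U h ->
    forall p, U (f p) -> bracket sM (g \o f) (h \o f) p = bracket sN g h (f p).

Definition anti_poisson_map (sM : bivector_field M) (sN : bivector_field N)
  (f : M -> N) : Prop := poisson_map sM (fun x => - sN x) f.

(* Hamiltonians are local holomorphic functions: a compact N has no other
   global ones than the locally constant functions. *)
Definition complete_map (sM : bivector_field M) (sN : bivector_field N)
    (f : M -> N) : Prop :=
  forall (U : set N) h, open U -> holo_fun U h ->
    complete_on U (hamiltonian sN h) ->
    complete_on (f @^-1` U) (hamiltonian sM (h \o f)).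

Definition surjective_submersion (f : M -> N) : Prop :=
  [/\ holo_map f, forall x, exists z, f z = x &
      forall z w, exists v, mdiff f z v = w].

Definition good_fibres (f : M -> N) : Prop :=
  forall x, connected (f @^-1` [set x]) /\ simply_connected R (f @^-1` [set x]).

End HolomorphicMaps.

Record morita_equivalence (R : realType) (nm np nz : nat)
    (Xm : complex_manifold R nm) (sm : bivector_field Xm)
    (Xp : complex_manifold R np) (sp : bivector_field Xp)
    (Z : complex_manifold R nz) (Om : cform2 Z)
    (pim : Z -> Xm) (pip : Z -> Xp) : Prop := MoritaEquivalence {
  morita_symplectic : holomorphic_symplectic Om;
  morita_submersion_m : surjective_submersion pim;
  morita_submersion_p : surjective_submersion pip;
  morita_fibres_m : good_fibres pim;
  morita_fibres_p : good_fibres pip;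
  morita_poisson_p : poisson_map (symplectic_bivector Om) sp pip;
  morita_poisson_m : anti_poisson_map (symplectic_bivector Om) sm pim;
  morita_orthogonal_p : forall z w, mdiff pip z w = 0 <->
    forall v, mdiff pim z v = 0 -> Om z w v = 0;
  morita_orthogonal_m : forall z w, mdiff pim z w = 0 <->
    forall v, mdiff pip z v = 0 -> Om z w v = 0;
  morita_complete_p : complete_map (symplectic_bivector Om) sp pip;
  morita_complete_m : complete_map (symplectic_bivector Om) sm pim
}.

(* The brane is the image of the embedding iota, identified with L; psim and
   psip are the inverses of the restrictions of pim and pip to the brane. *)
Record brane_bisection (R : realType) (nm np nz l : nat)
    (Xm : complex_manifold R nm) (Xp : complex_manifold R np)
    (Z : complex_manifold R nz) (Om : cform2 Z)
    (pim : Z -> Xm) (pip : Z -> Xp)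
    (L : smooth_manifold R l) (iota : L -> Z)
    (psim : Xm -> L) (psip : Xp -> L) : Prop := BraneBisection {
  brane_embedding : smooth_embedding iota;
  (* the tangent spaces of the brane are their own orthogonals for Im Om *)
  brane_lagrangian : forall p w, (exists u, mdiff iota p u = w) <->
    forall v, complex.Im (Om (iota p) w (mdiff iota p v)) = 0;
  brane_section_m : diffeo_pair (pim \o iota) psim;
  brane_section_p : diffeo_pair (pip \o iota) psip
}.

(* The pullback of the complex structure of X by the diffeomorphism phi, whose
   inverse is psi. *)
Definition induced_cs (R : realType) (l n : nat) (L : smooth_manifold R l)
    (X : complex_manifold R n) (phi : L -> X) (psi : X -> L)
    (p : L) (u : 'rV[R]_l) : 'rV[R]_l :=
  mdiff psi (phi p) (cJ (mdiff phi p u)).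

(* The real form F with iota^* Om = F%:C when iota^* (Im Om) = 0, see
   brane_formE. *)
Definition brane_form (R : realType) (l n : nat) (L : smooth_manifold R l)
    (Z : complex_manifold R n) (Om : cform2 Z) (iota : L -> Z)
    (p : L) (u v : 'rV[R]_l) : R :=
  complex.Re (Om (iota p) (mdiff iota p u) (mdiff iota p v)).

Lemma brane_formE (R : realType) (nm np nz l : nat)
    (Xm : complex_manifold R nm) (Xp : complex_manifold R np)
    (Z : complex_manifold R nz) (Om : cform2 Z)
    (pim : Z -> Xm) (pip : Z -> Xp)
    (L : smooth_manifold R l) (iota : L -> Z)
    (psim : Xm -> L) (psip : Xp -> L) :
  brane_bisection Om pim pip iota psim psip ->
  forall p u v, Om (iota p) (mdiff iota p u) (mdiff iota p v) =
                (brane_form Om iota p u v)%:C.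
Proof.
move=> B p u v; have /(_ v) := (brane_lagrangian B p _).1 (ex_intro _ u erefl).
by rewrite /brane_form; case: (Om _ _ _) => a b /= ->.
Qed.

Section Types.
Context {R : realType} {E : lmodType R}.
Variables (I : E -> E) (F : E -> E -> R).

(* The pair (a, b) stands for a + i b in the complexification of E. *)
Definition complexify (a b : E * E) : R[i] :=
  (F a.1 b.1 - F a.2 b.2) +i* (F a.1 b.2 + F a.2 b.1).

Definition proj10 (u : E) : E * E := (2^-1 *: u, - (2^-1 *: I u)).
Definition proj01 (u : E) : E * E := (2^-1 *: u, 2^-1 *: I u).

Definition form20 (u v : E) : R[i] := complexify (proj10 u) (proj10 v).
Definition form02 (u v : E) : R[i] := complexify (proj01 u) (proj01 v).
Definition form11 (u v : E) : R[i] :=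
  complexify (proj10 u) (proj01 v) + complexify (proj01 u) (proj10 v).

Lemma form11E (hF : forall a b u v, F (a *: u) (b *: v) = a * b * F u v) u v :
  form11 u v = ((F u v + F (I u) (I v)) / 2)%:C.
Proof.
rewrite /form11 /complexify /= -!scaleNr !hF.
by apply/eqP; rewrite eq_complex /=; apply/andP; split; apply/eqP; field.
Qed.

Lemma form20D02E (hF : forall a b u v, F (a *: u) (b *: v) = a * b * F u v) u v :
  form20 u v + form02 u v = ((F u v - F (I u) (I v)) / 2)%:C.
Proof.
rewrite /form20 /form02 /complexify /= -!scaleNr !hF.
by apply/eqP; rewrite eq_complex /=; apply/andP; split; apply/eqP; field.
Qed.

Definition tensor_S (u v : E) : R[i] := form11 (I u) v.
Definition tensor_A (u v : E) : R[i] := form20 (I u) v + form02 (I u) v.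

End Types.

(* Main.v *)
Require Import Defs.
From HB Require Import structures.
From mathcomp Require Import all_boot all_order all_algebra.
From mathcomp Require Import all_classical all_reals all_analysis.
From mathcomp.real_closed Require Import complex.
From mathcomp Require Import ring lra.
Set Implicit Arguments.
Unset Strict Implicit.
Unset Printing Implicit Defensive.
Import numFieldNormedType.Exports.
Import Order.TTheory GRing.Theory Num.Theory.
Local Open Scope classical_set_scope.
Local Open Scope ring_scope.

(* Write J for the complex structure of Z and identify L with its image.  For
   tangent vectors u, v of L, the vector I_+ u - J u lies in ker dpi_+ and
   I_- v - J v lies in ker dpi_-; these kernels are Omega-orthogonal.  Since
   Omega is complex bilinear and restricts to the real form F on L, the
   imaginary part of Omega(I_+ u - J u, I_- v - J v) = 0 reads
   F(I_+ u, v) = - F(u, I_- v).  Inserting this relation in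
   2 S_pm(u, v) = F(I_pm u, v) - F(u, I_pm v) and
   2 A_pm(u, v) = F(I_pm u, v) + F(u, I_pm v) gives both identities. *)

(** A differential depends only on the germ: the first-order expansion of [g] at [x] is also one of
    [f]. Chart expressions of composites and of the identity simplify only near the base point. *)
Lemma near_eq_is_diff (R : realType) (V W : normedModType R) (f g : V -> W)
    (x : V) (fg : \forall y \near x, f y = g y) (dg : differentiable g x) :
  is_diff x f ('d g x).
Proof.
have fE : f \o shift x = cst (f x) + 'd g x +o_ (0 : V) id.
  have /eqaddoP gE := diff_locally dg.
  have fgx : \forall h \near (0 : V), f (h + x) = g (h + x).
    by move: fg; rewrite (near_shift 0); apply: filterS => h /=; rewrite subr0.
  apply/eqaddoP => e e0; near=> h.
  rewrite /= !fctE /= (near fgx h)// (nbhs_singleton fg).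
  by near: h; exact: (gE _ e0).
have df : 'd f x = 'd g x :> (V -> W).
  by apply: diff_unique fE; exact: diff_continuous.
by apply: DiffDef => //; apply/diff_locallyP; rewrite df; split;
  [exact: diff_continuous|].
Unshelve. all: by end_near. Qed.

Section DiffMap.
Context {R : realType} {E E' : normedModType R}.
Context {G : set E -> (E -> E) -> Prop} {G' : set E' -> (E' -> E') -> Prop}.
Variables (M : manifold G) (N : manifold G').

(** A common weakening of smooth and holomorphic maps, so that one chain rule covers mixed
    composites such as [pi \o iota]. *)
Definition diff_map (f : M -> N) : Prop :=
  map_of_type (fun U g => forall x, U x -> differentiable g x) f.

Lemma map_of_type_diff (Q : set E -> (E -> E') -> Prop) (f : M -> N) :
  (forall U g, Q U g -> forall x, U x -> differentiable g x) ->
  map_of_type Q f -> diff_map f.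
Proof. by move=> QD [fc fQ]; split=> // c d cA dA; exact/QD/fQ. Qed.

Lemma diff_mapP (f : M -> N) (p : M) : diff_map f ->
  differentiable (chart_at (f p) \o f \o chart_inv (chart_at p)) (chart_at p p).
Proof.
move=> [_ /(_ _ _ (chart_at_atlas p) (chart_at_atlas (f p)))]; apply.
by exists p => //; split; exact: chart_at_dom.
Qed.

Lemma near_chart_inv (p : M) (A : set M) : open A -> A p ->
  \forall x \near chart_at p p, A (chart_inv (chart_at p) x).
Proof.
move=> Ao Ap; have pd := chart_at_dom p.
have /chart_inv_cont : (chart_at p @` chart_dom (chart_at p)) (chart_at p p).
  by exists p.
by apply; rewrite chart_mapK//; exact: open_nbhs_nbhs.
Qed.

End DiffMap.

Lemma mdiff_comp (R : realType) (E E' E'' : normedModType R)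
    (G : set E -> (E -> E) -> Prop) (G' : set E' -> (E' -> E') -> Prop)
    (G'' : set E'' -> (E'' -> E'') -> Prop)
    (M : manifold G) (N : manifold G') (P : manifold G'')
    (f : M -> N) (g : N -> P) (p : M) : diff_map f -> diff_map g ->
  mdiff (g \o f) p = mdiff g (f p) \o mdiff f p.
Proof.
move=> fD gD; have pd := chart_at_dom p; rewrite /mdiff.
set F := chart_at (f p) \o f \o _.
set H := chart_at (g (f p)) \o g \o _.
have Fp : F (chart_at p p) = chart_at (f p) (f p) by rewrite /F /= chart_mapK.
have dF : differentiable F (chart_at p p) by exact: diff_mapP.
have dH : differentiable H (F (chart_at p p)) by rewrite Fp; exact: diff_mapP.
transitivity ('d H (F (chart_at p p)) \o 'd F (chart_at p p)); last by rewrite Fp.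
rewrite -(diff_comp dF dH).
have [|_ ->//] := @near_eq_is_diff _ _ _
  (chart_at (g (f p)) \o (g \o f) \o chart_inv (chart_at p)) (H \o F)
  (chart_at p p) _ (differentiable_comp dF dH).
(* The middle chart cancels only where [f] lands in its domain; continuity of [f] makes this a
   neighbourhood of [p]. *)
have : \forall x \near chart_at p p,
    (f @^-1` chart_dom (chart_at (f p))) (chart_inv (chart_at p) x).
  apply: near_chart_inv; last exact: chart_at_dom.
  by apply: open_comp; [move=> ? _; exact: fD.1|exact: chart_dom_open].
by apply: filterS => x fx; rewrite /F /H /= chart_mapK.
Qed.

Lemma mdiff_id (R : realType) (E : normedModType R)
    (G : set E -> (E -> E) -> Prop) (M : manifold G) (p : M) :
  mdiff (id : M -> M) p = id.
Proof.
rewrite /mdiff; have pd := chart_at_dom p.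
have [|_ ->] := @near_eq_is_diff _ _ _
  (chart_at p \o id \o chart_inv (chart_at p)) id (chart_at p p) _
  (@ex_diff _ _ _ _ _ _ _ (is_diff_id _)); last by rewrite diff_val.
have : nbhs (chart_at p p) (chart_at p @` chart_dom (chart_at p)).
  by apply: open_nbhs_nbhs; split; [exact: chart_img_open|exists p].
by apply: filterS => _ [q qd <-] /=; rewrite chart_mapK.
Qed.

Lemma smooth_map_diff (R : realType) (E E' : normedModType R)
    (G : set E -> (E -> E) -> Prop) (G' : set E' -> (E' -> E') -> Prop)
    (M : manifold G) (N : manifold G') (f : M -> N) :
  smooth_map f -> diff_map f.
Proof. by apply: map_of_type_diff => U g /(_ 1%N) []. Qed.

Section Holo.
Context {R : realType} {m n : nat}.
Variables (M : complex_manifold R m) (N : complex_manifold R n).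

Lemma holo_map_diff (f : M -> N) : holo_map f -> diff_map f.
Proof. by apply: map_of_type_diff => U g [/(_ 1%N) []]. Qed.

Lemma mdiff_cJ (f : M -> N) (p : M) v : holo_map f ->
  mdiff f p (cJ v) = cJ (mdiff f p v).
Proof.
move=> [_ /(_ _ _ (chart_at_atlas p) (chart_at_atlas (f p)))[_]]; apply.
by exists p => //; split; exact: chart_at_dom.
Qed.

End Holo.

Section MdiffLinear.
Context {R : realType} {E E' : normedModType R}.
Context {G : set E -> (E -> E) -> Prop} {G' : set E' -> (E' -> E') -> Prop}.
Variables (M : manifold G) (N : manifold G') (f : M -> N) (p : M).

Lemma mdiffN u : mdiff f p (- u) = - mdiff f p u.
Proof. by rewrite /mdiff linearN. Qed.

Lemma mdiffB u v : mdiff f p (u - v) = mdiff f p u - mdiff f p v.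
Proof. by rewrite /mdiff linearB. Qed.

Lemma mdiffZ (a : R) u : mdiff f p (a *: u) = a *: mdiff f p u.
Proof. by rewrite /mdiff linearZ. Qed.

End MdiffLinear.

Lemma cJK (R : realType) n (x : Cn R n) : cJ (cJ x) = - x.
Proof. by case: x. Qed.

Section InducedStructure.
Context {R : realType} {l n : nat}.
Variables (L : smooth_manifold R l) (X : complex_manifold R n).
Variables (phi : L -> X) (psi : X -> L).
Hypothesis phi_psi : diffeo_pair phi psi.

Lemma mdiff_diffeoK p : cancel (mdiff phi p) (mdiff psi (phi p)).
Proof.
have [/smooth_map_diff dphi /smooth_map_diff dpsi phiK _] := phi_psi.
move=> u; have := mdiff_comp p dphi dpsi.
by rewrite (_ : psi \o phi = id) ?mdiff_id; [move=> /(congr1 (@^~ u))|exact/funext].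
Qed.

Lemma mdiff_diffeoVK p : cancel (mdiff psi (phi p)) (mdiff phi p).
Proof.
have [/smooth_map_diff dphi /smooth_map_diff dpsi phiK psiK] := phi_psi.
move=> u; have := mdiff_comp (phi p) dpsi dphi.
(* The chain rule is applied at [phi p]; [phiK] turns the resulting base point [psi (phi p)] back
   into [p]. *)
rewrite (_ : phi \o psi = id) ?mdiff_id ?phiK; last exact/funext.
by move=> /(congr1 (@^~ u)).
Qed.

Lemma mdiff_induced_cs p u :
  mdiff phi p (induced_cs phi psi p u) = cJ (mdiff phi p u).
Proof. exact: mdiff_diffeoVK. Qed.

Lemma induced_csK p u : induced_cs phi psi p (induced_cs phi psi p u) = - u.
Proof.
rewrite {1}/induced_cs mdiff_induced_cs cJK.
by rewrite mdiffN mdiff_diffeoK.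
Qed.

End InducedStructure.

(** Both terms have the image [cJ (mdiff (pi \o iota) p u)]: the first since the structure on the
    brane is pulled back from [X], the second since [pi] is holomorphic. *)
Lemma induced_cs_defect (R : realType) (l n m : nat) (L : smooth_manifold R l)
    (X : complex_manifold R n) (Z : complex_manifold R m)
    (iota : L -> Z) (pi : Z -> X) (psi : X -> L) (p : L) (u : 'rV[R]_l) :
  smooth_map iota -> holo_map pi -> diffeo_pair (pi \o iota) psi ->
  mdiff pi (iota p)
    (mdiff iota p (induced_cs (pi \o iota) psi p u) - cJ (mdiff iota p u)) = 0.
Proof.
move=> /smooth_map_diff di hpi D; have dpi := holo_map_diff hpi.
have dphi w : mdiff pi (iota p) (mdiff iota p w) = mdiff (pi \o iota) p w.
  by rewrite (mdiff_comp p di dpi).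
by rewrite mdiffB mdiff_cJ// !dphi mdiff_induced_cs// subrr.
Qed.

Section Types.
Context {R : realType} {E : lmodType R}.
Variables (I : E -> E) (F : E -> E -> R).
Hypotheses (FZ : forall a b u v, F (a *: u) (b *: v) = a * b * F u v).
Hypothesis IK : forall u, I (I u) = - u.

Lemma bihomogeneousNl u v : F (- u) v = - F u v.
Proof. by have := FZ (-1) 1 u v; rewrite scaleN1r scale1r mulr1 mulN1r. Qed.

(** With I^2 = -1, the term F(I(Iu), Iv) of the type projection becomes -F(u, Iv). *)
Lemma tensor_SE u v : tensor_S I F u v = (((F (I u) v - F u (I v)) / 2)%:C)%C.
Proof. by rewrite /tensor_S form11E// IK bihomogeneousNl. Qed.

Lemma tensor_AE u v : tensor_A I F u v = (((F (I u) v + F u (I v)) / 2)%:C)%C.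
Proof. by rewrite /tensor_A form20D02E// IK bihomogeneousNl opprK. Qed.

End Types.

Theorem proposition4p4 (R : realType) (nm np nz l : nat)
    (Xm : complex_manifold R nm) (sm : bivector_field Xm)
    (Xp : complex_manifold R np) (sp : bivector_field Xp)
    (Z : complex_manifold R nz) (Om : cform2 Z)
    (pim : Z -> Xm) (pip : Z -> Xp)
    (L : smooth_manifold R l) (iota : L -> Z)
    (psim : Xm -> L) (psip : Xp -> L)
    (sm_poisson : holomorphic_poisson sm)
    (sp_poisson : holomorphic_poisson sp)
    (ZM : morita_equivalence sm sp Om pim pip)
    (LB : brane_bisection Om pim pip iota psim psip) :
  let F := brane_form Om iota in
  let Iplus := induced_cs (pip \o iota) psip in
  let Iminus := induced_cs (pim \o iota) psim in
  forall (p : L) (u v : 'rV[R]_l),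
    tensor_S (Iplus p) (F p) u v = tensor_S (Iminus p) (F p) u v /\
    tensor_A (Iplus p) (F p) u v = - tensor_A (Iminus p) (F p) u v.
Proof.
move=> F Ip Im p u v.
have [OmL [OmN _]] := morita_symplectic ZM.
have [iS _ _ _] := brane_embedding LB.
have [hm _ _] := morita_submersion_m ZM.
have [hp _ _] := morita_submersion_p ZM.
have Dm := brane_section_m LB; have Dp := brane_section_p LB.
set z := iota p; set d := mdiff iota p.
have OmJ w w' : Om z (cJ w) w' = 'i%C * Om z w w' by have [_ ->] := OmL z w'.
have OmZ a w w' : Om z (a *: w) w' = a%:C%C * Om z w w'.
  (* The instance at -1, 0, 0 gives [Om z 0 w' = 0], which removes the additive term from the
     instance at [a], [w], 0. *)
  have [D _] := OmL z w'; have := D (-1) 0 0; have := D a w 0.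
  by rewrite scaler0 !addr0 rmorphN1 mulN1r addNr => -> ->; rewrite addr0.
have OmB w1 w2 w' : Om z (w1 - w2) w' = Om z w1 w' - Om z w2 w'.
  have [D _] := OmL z w'; have := D (-1) w2 w1.
  by rewrite scaleN1r addrC => ->; rewrite rmorphN1 mulN1r addrC.
have OmBr w1 w2 w' : Om z w' (w1 - w2) = Om z w' w1 - Om z w' w2.
  by rewrite OmN OmB (OmN z w' w1) (OmN z w' w2) opprB opprK addrC.
have OmJr w w' : Om z w (cJ w') = 'i%C * Om z w w'.
  by rewrite OmN OmJ (OmN z w w') mulrN.
have OmF a b : Om z (d a) (d b) = (F p a b)%:C%C := brane_formE LB p a b.
have FN a b : F p a b = - F p b a.
  by have := OmN z (d a) (d b); rewrite !OmF => -[].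
have FZ a b w w' : F p (a *: w) (b *: w') = a * b * F p w w'.
  have FZl c x y : F p (c *: x) y = c * F p x y.
    by have := OmF (c *: x) y; rewrite /d mdiffZ OmZ -/d OmF -rmorphM => -[].
  by rewrite FZl FN FZl (FN w w') !mulrN mulrA.
have rel a b : F p (Ip p a) b = - F p a (Im p b).
  have /(morita_orthogonal_p ZM) := induced_cs_defect p a iS hp Dp.
  move=> /(_ _ (induced_cs_defect p b iS hm Dm)).
  rewrite -/z -/d OmB !OmBr !OmJ !OmJr !OmF => /eqP.
  (* The expanded pairing is F(I_+ a, I_- b) - F(a, b) - i (F(I_+ a, b) + F(a, I_- b)); its
     imaginary part is kept. *)
  rewrite eq_complex /= => /andP[_ /eqP].
  by rewrite -/(Ip p a) -/(Im p b) => h; lra.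
(* The mirror relation follows from [rel] by antisymmetry of F, with the two arguments exchanged. *)
have rel' a b : F p (Im p a) b = - F p a (Ip p b).
  by rewrite FN -rel FN.
rewrite !tensor_SE ?tensor_AE//; do ?exact: induced_csK.
(* Only x = F(u, I_+ v) and y = F(u, I_- v) remain: both S are -(x + y)/2, while A_+ is (x - y)/2
   and A_- is (y - x)/2. *)
rewrite rel rel' -rmorphN; split; congr (_%:C%C); ring.
Qed.
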